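(* Let $M$ be a smooth manifold, let $L:T_k^1M\to\mathbb{R}$ be a regular Lagrangian, and consider the $k$-symplectic Lagrangian system $\left(T_k^1M,(\omega_L)_A,E_L\right)$. Let $\mathbf{X}=(X_1,\dots,X_k)$ be an integrable evolution $k$-vector field associated to $H=E_L$, i.e. $\mathbf{X}$ is an integrable $k$-vector field on $T_k^1M$ with $\sum_{A=1}^{k}i_{X_A}(\omega_L)_A=dE_L$. Suppose that $L_{X_A}(\omega_L)_A=0$ for each $A=1,\dots,k$ (Lie derivative along $X_A$, no summation over $A$). Let $Y$ be a vector field on $T_k^1M$ which is a symmetry of $\mathbf{X}$, and let $\mathbf{Y}=(Y,\dots,Y)$ be the $k$-vector field on $T_k^1M$ all of whose $k$ components equal $Y$. If $S$ is a vector field on $T_k^1M$ which is a $\mathbf{Y}$-pseudosymmetry of $\mathbf{X}$, then the map $\mathbf{\Phi}=(\Phi_1,\dots,\Phi_k)$ defined by $$\Phi_A=(\omega_L)_A(S,Y),\qquad A=1,\dots,k,$$ is a conservation law for $\mathbf{X}=(X_1,\dots,X_k)$. In particular, if $Y$ and $S$ are symmetries of $\mathbf{X}$, then $\mathbf{\Phi}$ is a conservation law for $\mathbf{X}$.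
   Context: All manifolds, maps, vector fields and forms are $C^\infty$. For a vector field $X$, $L_X$ denotes the Lie derivative (for vector fields $L_XY=[X,Y]$) and $i_X$ the interior product; the letter $L$ without a vector-field subscript denotes the Lagrangian. $T_k^1M=TM\oplus\cdots\oplus TM$ (Whitney sum of $k$ copies of $TM$) is the $k$-tangent bundle of $M$, with natural coordinates $(x^i,v_A^i)$, $1\le i\le n=\dim M$, $1\le A\le k$. The Liouville vector field is locally $\Delta=\sum_{A=1}^{k}\sum_i v_A^i\frac{\partial}{\partial v_A^i}$, and the $k$-tangent structure is the family $(S^1,\dots,S^k)$ of $(1,1)$-tensor fields given locally by $S^A=\sum_i\frac{\partial}{\partial v_A^i}\otimes dx^i$. For a Lagrangian $L:T_k^1M\to\mathbb{R}$ put $(\theta_L)_A=dL\circ S^A$ (locally $\sum_i\frac{\partial L}{\partial v_A^i}dx^i$), $(\omega_L)_A=-d(\theta_L)_A$, and $E_L=\Delta(L)-L$. $L$ is regular if the matrix $\left(\frac{\partial^2L}{\partial v_A^i\partial v_B^j}\right)$ (rows indexed by $(i,A)$, columns by $(j,B)$) is invertible at every point of $T_k^1M$. A $k$-vector field on a manifold $\mathcal{M}$ is a section of the Whitney sum $T\mathcal{M}\oplus\cdots\oplus T\mathcal{M}$ ($k$ copies), i.e. a $k$-tuple $\mathbf{X}=(X_1,\dots,X_k)$ of vector fields on $\mathcal{M}$. An integral section of $\mathbf{X}$ at $x\in\mathcal{M}$ is a map $\psi:U_0\subset\mathbb{R}^k\to\mathcal{M}$, with $U_0$ an open neighbourhood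 of $0$, such that $\psi(0)=x$ and $\psi_*(t)\left(\frac{\partial}{\partial t^A}(t)\right)=X_A(\psi(t))$ for every $t\in U_0$ and every $A=1,\dots,k$. $\mathbf{X}$ is integrable if there is an integral section at every point of $\mathcal{M}$. A map $\mathbf{\Phi}=(\Phi_1,\dots,\Phi_k):\mathcal{M}\to\mathbb{R}^k$ is a conservation law for the $k$-vector field $\mathbf{X}$ on $\mathcal{M}$ if $\sum_{A=1}^{k}L_{X_A}\Phi_A=0$. A vector field $Y$ on $\mathcal{M}$ is a symmetry of $\mathbf{X}$ if $L_{X_A}Y=0$ for all $A=1,\dots,k$. Given a fixed $k$-vector field $\mathbf{Z}=(Z_1,\dots,Z_k)$ on $\mathcal{M}$, a vector field $S$ on $\mathcal{M}$ is a $\mathbf{Z}$-pseudosymmetry of $\mathbf{X}$ if for every $A=1,\dots,k$ there are functions $\lambda_A^B\in C^\infty(\mathcal{M})$, $B=1,\dots,k$, such that $L_{X_A}S=\sum_{B=1}^{k}\lambda_A^B Z_B$. *)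

(* Defs.v *)
From HB Require Import structures.
From mathcomp Require Import all_boot all_order all_algebra.
From mathcomp Require Import all_classical all_reals all_analysis.
Set Implicit Arguments.
Unset Strict Implicit.
Unset Printing Implicit Defensive.
Import Order.TTheory GRing.Theory Num.Theory.
Import numFieldNormedType.Exports.
Local Open Scope classical_set_scope.
Local Open Scope ring_scope.

(* C^infty on the open set A: every iterated directional derivative of f
   (the directions in s, the last one taken first) is Frechet differentiable at
   every point of A.  Directions are constant, so for U = R^m these are the
   linear combinations of the iterated partial derivatives. *)
Definition smooth_on (R : realType) (U V : normedModType R) (A : set U)
    (f : U -> V) : Prop :=
  forall (s : seq U) (x : U), A x ->
    differentiable (foldr (fun v g => 'D_v g) f s) x.

(* Chart data on a set, modelled on R^m = 'rV[R]_m.  The chart c is the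
   bijection phi c from dom c onto tgt c, with inverse psi c; values outside
   dom c and tgt c are irrelevant.  chart_at selects a chart around each point.
   The laws are in is_manifold. *)
Record charted (R : realType) (m : nat) := Charted {
  pt :> Type;
  idx : Type;
  dom : idx -> set pt;
  tgt : idx -> set 'rV[R]_m;
  phi : idx -> pt -> 'rV[R]_m;
  psi : idx -> 'rV[R]_m -> pt;
  chart_at : pt -> idx }.
Arguments dom {R m c0} _ _ : rename.
Arguments tgt {R m c0} _ _ : rename.
Arguments phi {R m c0} _ _ : rename.
Arguments psi {R m c0} _ _ : rename.
Arguments chart_at {R m c0} _ : rename.

(* The topology induced by the charts. *)
Definition mopen (R : realType) (m : nat) (N : charted R m) (O : set N) : Prop :=
  forall c : idx N, open (tgt c `&` psi c @^-1` O).

Record is_manifold (R : realType) (m : nat) (N : charted R m) : Prop := IsManifold {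
  mfd_chart_at : forall p : N, dom (chart_at p) p;
  mfd_phi : forall (c : idx N) p, dom c p -> tgt c (phi c p);
  mfd_psi : forall (c : idx N) x, tgt c x -> dom c (psi c x);
  mfd_phiK : forall (c : idx N) p, dom c p -> psi c (phi c p) = p;
  mfd_psiK : forall (c : idx N) x, tgt c x -> phi c (psi c x) = x;
  mfd_open : forall c : idx N, open (tgt c);
  mfd_overlap : forall c c' : idx N, open (tgt c `&` psi c @^-1` dom c');
  mfd_transition : forall c c' : idx N,
    smooth_on (tgt c `&` psi c @^-1` dom c') (phi c' \o psi c);
  mfd_hausdorff : forall p q : N, p <> q -> exists O O' : set N,
    [/\ mopen O, mopen O', O p, O' q & O `&` O' = set0];
  mfd_second_countable : exists B : nat -> set N,
    (forall i, mopen (B i)) /\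
    (forall (O : set N) p, mopen O -> O p -> exists i, B i p /\ B i `<=` O) }.

(* The tangent space at p is identified with R^m by means of the chart
   chart_at p: a vector v : 'rV_m at p is the tangent vector with coordinates v
   in that chart.  Tangent vectors, vector fields and forms are thus given, at
   each point p, by their components in chart_at p; to_chart c p v are the
   coordinates of v in another chart c around p, and from_chart c p is the
   inverse change of coordinates. *)
Section Calculus.
Variables (R : realType) (m : nat) (N : charted R m).
Implicit Types (p : N) (c : idx N) (x u v : 'rV[R]_m).

Definition to_chart c p v : 'rV[R]_m :=
  'D_v (phi c \o psi (chart_at p)) (phi (chart_at p) p).

Definition from_chart c p u : 'rV[R]_m :=
  'D_u (phi (chart_at p) \o psi c) (phi c p).

Definition vfield := N -> 'rV[R]_m.
Definition form1 := N -> 'rV[R]_m -> R.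
Definition form2 := N -> 'rV[R]_m -> 'rV[R]_m -> R.

(* Local representatives in the chart c, functions of x in tgt c. *)
Definition vf_rep c (X : vfield) x : 'rV[R]_m :=
  to_chart c (psi c x) (X (psi c x)).

Definition form1_rep c (theta : form1) x u : R :=
  theta (psi c x) (from_chart c (psi c x) u).

Definition form2_rep c (omega : form2) x u v : R :=
  omega (psi c x) (from_chart c (psi c x) u) (from_chart c (psi c x) v).

Definition smooth_map (V : normedModType R) (f : N -> V) : Prop :=
  forall c, smooth_on (tgt c) (f \o psi c).

Definition smooth_vf (X : vfield) : Prop :=
  forall c, smooth_on (tgt c) (vf_rep c X).

Definition dfun (f : N -> R) : form1 := fun p v =>
  'D_v (f \o psi (chart_at p)) (phi (chart_at p) p).

Definition lie_fun (X : vfield) (f : N -> R) : N -> R := fun p => dfun f p (X p).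

(* [X, Y]^i = X^j dY^i/dx^j - Y^j dX^i/dx^j in the chart chart_at p. *)
Definition lie_vf (X Y : vfield) : vfield := fun p =>
  let c := chart_at p in
  'D_(X p) (vf_rep c Y) (phi c p) - 'D_(Y p) (vf_rep c X) (phi c p).

(* (d theta)_ij = d theta_j/dx^i - d theta_i/dx^j in the chart chart_at p. *)
Definition dform1 (theta : form1) : form2 := fun p u v =>
  let c := chart_at p in
  'D_u (fun x => form1_rep c theta x v) (phi c p)
  - 'D_v (fun x => form1_rep c theta x u) (phi c p).

(* (L_X omega)_ij = X^l d omega_ij/dx^l + omega_lj dX^l/dx^i + omega_il dX^l/dx^j
   in the chart chart_at p. *)
Definition lie_form2 (X : vfield) (omega : form2) : form2 := fun p u v =>
  let c := chart_at p in
  'D_(X p) (fun x => form2_rep c omega x u v) (phi c p)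
  + omega p ('D_u (vf_rep c X) (phi c p)) v
  + omega p u ('D_v (vf_rep c X) (phi c p)).

Definition iprod (X : vfield) (omega : form2) : form1 := fun p v =>
  omega p (X p) v.

Section KVectorFields.
Variables (k : nat) (X : 'I_k -> vfield).

Definition smooth_kvf : Prop := forall A, smooth_vf (X A).

Definition integral_section (p : N) (U0 : set 'rV[R]_k) (f : 'rV[R]_k -> N) : Prop :=
  [/\ open U0, U0 0 & f 0 = p] /\
  [/\ (forall c, open (U0 `&` f @^-1` dom c)),
      (forall c, smooth_on (U0 `&` f @^-1` dom c) (phi c \o f)) &
      (forall t, U0 t -> forall A : 'I_k,
         'D_(delta_mx 0 A) (phi (chart_at (f t)) \o f) t = X A (f t))].

Definition integrable_kvf : Prop :=
  forall p : N, exists U0 f, integral_section p U0 f.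

Definition conservation_law (Phi : N -> 'rV[R]_k) : Prop :=
  smooth_map Phi /\
  forall p : N, \sum_(A < k) lie_fun (X A) (fun q => Phi q 0 A) p = 0.

Definition symmetry (Y : vfield) : Prop :=
  forall (A : 'I_k) p, lie_vf (X A) Y p = 0.

Definition pseudosymmetry (Z : 'I_k -> vfield) (S : vfield) : Prop :=
  forall A : 'I_k, exists lambda : 'I_k -> N -> R,
    (forall B, smooth_map (lambda B)) /\
    (forall p, lie_vf (X A) S p = \sum_(B < k) lambda B p *: Z B p).

End KVectorFields.
End Calculus.

(* The k-tangent bundle: a point is (p, v), the rows of v being k tangent vectors
   at p.  The natural chart over the chart c of M has coordinates
   row_mx x (mxvec w), with x the coordinates x^i of p and w A i = v_A^i. *)
Definition Tk1 (R : realType) (n k : nat) (M : charted R n) : charted R (n + k * n) :=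
  @Charted R (n + k * n) (M * 'M[R]_(k, n))%type (idx M)
    (fun c q => dom c q.1)
    (fun c y => tgt c (lsubmx y))
    (fun c q => row_mx (phi c q.1) (mxvec (\matrix_(A < k) to_chart c q.1 (row A q.2))))
    (fun c y => let p := psi c (lsubmx y) in
                (p, \matrix_(A < k) from_chart c p (row A (vec_mx (rsubmx y)))))
    (fun q => chart_at q.1).

Section Lagrangian.
Variables (R : realType) (n k : nat) (M : charted R n).
Local Notation TkM := (Tk1 k M).

(* d/dv_A^i in natural coordinates *)
Definition ddv (A : 'I_k) (i : 'I_n) : 'rV[R]_(n + k * n) :=
  row_mx 0 (mxvec (delta_mx A i)).

Definition vcoord (c : idx TkM) (q : TkM) (A : 'I_k) (i : 'I_n) : R :=
  vec_mx (rsubmx (phi c q)) A i.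

Definition liouville : vfield TkM := fun q =>
  \sum_(A < k) \sum_(i < n) vcoord (chart_at q) q A i *: ddv A i.

(* S^A = sum_i d/dv_A^i (x) dx^i, as an endomorphism of the tangent space at q *)
Definition ktangent (A : 'I_k) (q : TkM) (w : 'rV[R]_(n + k * n)) :
    'rV[R]_(n + k * n) :=
  \sum_(i < n) lsubmx w 0 i *: ddv A i.

Variable L : TkM -> R.

Definition theta_L (A : 'I_k) : form1 TkM := fun q w => dfun L q (ktangent A q w).

Definition omega_L (A : 'I_k) : form2 TkM := fun q u w => - dform1 (theta_L A) q u w.

Definition energy : TkM -> R := fun q => lie_fun liouville L q - L q.

(* The pairs (A, i) are numbered by mxvec_index; ddv A i is the unit vector of
   number mxvec_index A i in the fibre directions. *)
Definition hessian (c : idx TkM) (q : TkM) : 'M[R]_(k * n) :=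
  \matrix_(a, b) 'D_(row_mx 0 (delta_mx 0 a))
    ('D_(row_mx 0 (delta_mx 0 b)) (L \o psi c)) (phi c q).

Definition regular_lagrangian : Prop :=
  forall (c : idx TkM) (q : TkM), dom c q -> hessian c q \in unitmx.

Definition evolution (H : TkM -> R) (X : 'I_k -> vfield TkM) : Prop :=
  forall q w, \sum_(A < k) iprod (X A) (omega_L A) q w = dfun H q w.

End Lagrangian.

(* Main.v *)
From HB Require Import structures.
Require Import Defs.
From mathcomp Require Import all_boot all_order all_algebra.
From mathcomp Require Import all_classical all_reals all_analysis.
From mathcomp Require Import ring.
Set Implicit Arguments.
Unset Strict Implicit.
Unset Printing Implicit Defensive.
Import Order.TTheory GRing.Theory Num.Theory.
Import numFieldNormedType.Exports.
Local Open Scope classical_set_scope.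
Local Open Scope ring_scope.

(** Fix A and write omega for the A-th form of the family.  The Lie derivative
    obeys the Leibniz rule for contractions,
      X(omega(S, Y)) = (L_X omega)(S, Y) + omega([X, S], Y) + omega(S, [X, Y]).
    With X = X_A the first term vanishes by assumption and the last one because
    Y is a symmetry.  A pseudosymmetry S with respect to (Y, ..., Y) has [X_A, S]
    pointwise proportional to Y, so the middle term is a multiple of
    omega(Y, Y) = 0.  Every summand of sum_A X_A(Phi_A) is thus zero.

    The Leibniz rule is [lie_contraction].  Tensors are given at each point in
    the chart attached to that point, and this chart may jump from one point to
    the next; a function such as omega(S, Y) can only be differentiated once it
    is expressed in one fixed chart c on a whole neighbourhood.  So the main work
    is [omega_L_rep]: in every natural chart, omega is given by
      omega(u, v) = D_v D_(K u) l - D_u D_(K v) l,     l = L o psi_c,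
    where K is the endomorphism S^A in coordinates ([omega_loc]).  That this
    expression is invariant under a change of natural charts is
    [omega_loc_prolong].  Such a change is the prolongation
    (x, w) |-> (tau x, D tau(x) w_1, ..., D tau(x) w_k) of a change of charts tau
    of M; it intertwines K with K ([derive_vlift_prolong]), which gives the
    invariance of theta, and the second derivatives of tau that show up in
    d theta cancel by the symmetry of mixed derivatives ([derive_swap]).

    Smoothness of Phi follows from the same formula, since in a chart it is a
    polynomial in the components of S and Y and in derivatives of l. *)

(** * Directional derivatives *)

Section Derivatives.
Variable R : realType.

Lemma derive_comp (U V W : normedModType R) (f : U -> V) (g : V -> W) x v :
  differentiable f x -> differentiable g (f x) ->
  'D_v (g \o f) x = 'D_('D_v f x) g (f x).
Proof.
move=> df dg; rewrite (deriveE _ (differentiable_comp df dg)).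
by rewrite (deriveE _ df) (deriveE _ dg) (diff_comp df dg).
Qed.

(** This form also applies to maps that are affine along one direction only, such as
    the prolongation of a nonlinear map along the fibres. *)
Lemma derive_affine (U V : normedModType R) (f : U -> V) a v b :
  (forall h : R, f (h *: v + a) = h *: b + f a) -> 'D_v f a = b.
Proof.
move=> fh; apply: cvg_lim => //.
apply: (@cvg_near_cst _ _ (b : V)).
near=> h; rewrite /= fh addrK scalerA mulVf ?scale1r//.
by near: h; exact: nbhs_dnbhs_neq.
Unshelve. all: by end_near. Qed.

Lemma derive_linear (U V : normedModType R) (f : {linear U -> V}) x v :
  'D_v f x = f v.
Proof. by apply: derive_affine => h; rewrite linearP. Qed.

Lemma derive_dirP (U V : normedModType R) (f : U -> V) x : differentiable f x ->
  linear (fun v => 'D_v f x).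
Proof. by move=> df a u v; rewrite !(deriveE _ df) linearP. Qed.

(** The differential of f is also a first order approximation of g, because the two
    agree on a whole neighbourhood. *)
Lemma near_differentiable (U V : normedModType R) (f g : U -> V) x :
  (\forall y \near x, f y = g y) -> differentiable f x -> differentiable g x.
Proof.
move=> fg df; have [cf ef] := (diff_locallyP _ _).1 df.
have eg : g \o shift x = cst (g x) + 'd f x +o_ 0 id.
  apply/eqaddoP => e e0; have /eqaddoP/(_ e e0) := ef.
  have fg0 : \forall h \near 0, f (h + x) = g (h + x).
    by move: fg; rewrite (near_shift 0 x); apply: filterS => h /=; rewrite subr0.
  apply: filter_app; move: fg0; apply: filterS => h fgh.
  rewrite /= -![(_ - _ : _ -> _) _]/(_ - _) -![(_ + _ : _ -> _) _]/(_ + _) /=.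
  by rewrite -(nbhs_singleton fg) fgh.
have dgE := diff_unique cf eg.
by apply/diff_locallyP; rewrite dgE.
Qed.

Lemma differentiable_mx (U : normedModType R) m n (F : U -> 'M[R]_(m, n)) x :
  (forall i j, differentiable (fun y => F y i j) x) -> differentiable F x.
Proof.
move=> dF.
have -> : F = \sum_(i < m) \sum_(j < n) (fun y => F y i j *: delta_mx i j).
  apply/funext => y; rewrite [LHS]matrix_sum_delta fct_sumE.
  by apply: eq_bigr => i _; rewrite fct_sumE.
do 2!(apply: differentiable_sum => ?).
exact: differentiableZl.
Qed.

Lemma differentiable_entry (U : normedModType R) m n (F : U -> 'M[R]_(m, n)) x i j :
  differentiable F x -> differentiable (fun y => F y i j) x.
Proof. by move=> dF; exact: (differentiable_comp dF (differentiable_coord (F x) i j)). Qed.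

Lemma derive_entry (U : normedModType R) m n (F : U -> 'M[R]_(m, n)) x v i j :
  differentiable F x -> 'D_v (fun y => F y i j) x = 'D_v F x i j.
Proof. by move=> dF; rewrite derive_mx ?mxE//; exact: diff_derivable. Qed.

Lemma scalar_row_delta m (l : 'rV[R]_m -> R) w :
  scalar l -> l w = \sum_(i < m) w 0 i * l (delta_mx 0 i).
Proof.
move=> ll; pose lM := GRing.isLinear.Build R 'rV[R]_m R^o *%R l ll.
pose lL : {scalar 'rV[R]_m} := HB.pack l lM.
have lE v : l v = lL v by [].
rewrite lE [w in LHS]row_sum_delta linear_sum; apply: eq_bigr => i _.
by rewrite linearZ.
Qed.

(** Leibniz rule for a family of linear forms W applied to a moving vector S.
    Both factors are expanded along the standard basis, which turns the pairing
    into a finite sum of products of functions. *)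
Section Leibniz.
Variables (U : normedModType R) (m : nat) (W : U -> 'rV[R]_m -> R).
Variables (S : U -> 'rV[R]_m) (x : U).
Hypothesis linW : \forall y \near x, scalar (W y).
Hypothesis dW : forall e, differentiable (W^~ e) x.
Hypothesis dS : differentiable S x.

Lemma pairing_nearE : \forall y \near x,
  (\sum_(i < m) (fun y => S y 0 i) * W^~ (delta_mx 0 i)) y = W y (S y).
Proof.
apply: filterS linW => y lin.
by rewrite (scalar_row_delta _ lin) fct_sumE.
Qed.

Lemma differentiable_pairing : differentiable (fun y => W y (S y)) x.
Proof.
apply: (near_differentiable pairing_nearE).
apply: differentiable_sum => i; apply: differentiableM => //.
exact: differentiable_entry.
Qed.

Lemma derive_pairing v :
  'D_v (fun y => W y (S y)) x = 'D_v (W^~ (S x)) x + W x ('D_v S x).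
Proof.
have linx := nbhs_singleton linW.
rewrite -(near_eq_derive _ pairing_nearE) derive_sum; last first.
  move=> i; apply: derivableM; apply: diff_derivable => //.
  exact: differentiable_entry.
have -> : 'D_v (W^~ (S x)) x = \sum_(i < m) S x 0 i * 'D_v (W^~ (delta_mx 0 i)) x.
  transitivity ('D_v (\sum_(i < m) (S x 0 i *: W^~ (delta_mx 0 i))) x).
    apply: near_eq_derive; apply: filterS linW => y lin.
    by rewrite (scalar_row_delta _ lin) fct_sumE.
  rewrite derive_sum; last by move=> i; apply: derivableZ; apply: diff_derivable.
  by apply: eq_bigr => i _; rewrite deriveZ//; apply: diff_derivable.
rewrite (scalar_row_delta _ linx) -big_split; apply: eq_bigr => i _ /=.
rewrite deriveM; [|by apply: diff_derivable => //; exact: differentiable_entry..].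
by rewrite derive_entry// ![_ *: _]mulrC mulrC.
Qed.

End Leibniz.
End Derivatives.

(** * Symmetry of mixed derivatives *)

Section Schwarz.
Variables (R : realType) (U : normedModType R).

Lemma is_derive_line (V : normedModType R) (f : U -> V) a w (s : R) :
  differentiable f (s *: w + a) ->
  is_derive s (1 : R) (fun r : R => f (r *: w + a)) ('D_w f (s *: w + a)).
Proof.
move=> df; pose l (r : R) := r *: w + a.
have dl : differentiable l s.
  apply: differentiableD; last exact: differentiable_cst.
  by apply: differentiableZl; exact: ex_diff.
apply: DeriveDef.
  by apply: diff_derivable; exact: (@differentiable_comp _ _ _ _ l f).
rewrite (@derive_comp _ _ _ _ l f)//; congr ('D_ _ f _).
by apply: derive_affine => h; rewrite /l scalerDl [h *: 1]mulr1 addrA.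
Qed.

(** The second difference is the increment over [0, 1] of
    s |-> f (x + s t u + t v) - f (x + s t u).  By the mean value theorem it equals
    t times a difference of two values of D_u f at points within O(t) of x, and
    the differentiability of D_u f at x evaluates that difference up to o(t). *)
Lemma second_difference (f : U -> R) x u v (e : R) :
  (\forall y \near x, differentiable f y) -> differentiable ('D_u f) x -> 0 < e ->
  \forall t \near (0 : R)^'+,
    `|f (t *: u + (t *: v + x)) - f (t *: u + x) - f (t *: v + x) + f x
      - t * t * 'D_v ('D_u f) x| <= e * (t * t).
Proof.
move=> df dDf e0; (* For 0 <= s <= 1, the points visited are at distance at most t C from x. *)
pose C : R := `|u| + `|v| + 1.
have C0 : 0 < C by rewrite ltr_wpDl// addr_ge0.
have e1 : 0 < e / (2 * C) by rewrite divr_gt0// mulr_gt0.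
have near0 : \forall h \near (0 : U), differentiable f (h + x) /\
    `|'D_u f (h + x) - 'D_u f x - 'd ('D_u f) x h| <= e / (2 * C) * `|h|.
  apply: filterI.
    by move: df; rewrite (near_shift 0 x); apply: filterS => h /=; rewrite subr0.
  have /eqaddoP/(_ _ e1) := diff_locally dDf.
  apply: filterS => h.
  by rewrite -![(_ - _ : _ -> _) _]/(_ - _) -![(_ + _ : _ -> _) _]/(_ + _) /= opprD addrA.
move/nbhs_norm0P: near0 => [d /= d0 hd].
near=> t.
have t0 : 0 < t by near: t; exact: nbhs_right_gt.
have tC : t * C < d.
  rewrite -ltr_pdivlMr//; near: t; apply: nbhs_right_lt; exact: divr_gt0.
have small_u (s : R) : 0 <= s <= 1 -> `|s *: (t *: u)| <= t * `|u|.
  move=> /andP[s0 s1]; rewrite !normrZ (ger0_norm s0) (gtr0_norm t0).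
  by rewrite ler_piMl// mulr_ge0// ltW.
have small_u' (s : R) : 0 <= s <= 1 -> `|s *: (t *: u)| <= t * C.
  move=> s01; apply: (le_trans (small_u _ s01)).
  by rewrite ler_pM2l// /C -addrA lerDl addr_ge0.
have small_uv (s : R) : 0 <= s <= 1 -> `|s *: (t *: u) + t *: v| <= t * C.
  move=> s01; apply: (le_trans (ler_normD _ _)).
  apply: (@le_trans _ _ (t * `|u| + t * `|v|)).
    by rewrite lerD ?small_u// normrZ (gtr0_norm t0).
  by rewrite /C !mulrDr mulr1 lerDl ltW.
pose g (s : R) := f (s *: (t *: u) + (t *: v + x)) - f (s *: (t *: u) + x).
pose dg (s : R) := 'D_(t *: u) f (s *: (t *: u) + (t *: v + x))
                 - 'D_(t *: u) f (s *: (t *: u) + x).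
have gdg (s : R) : 0 <= s <= 1 -> is_derive s 1 g (dg s).
  move=> s01; apply: is_deriveB.
    apply: is_derive_line; rewrite addrA; apply: (hd _ _).1 => /=.
    exact: le_lt_trans (small_uv _ s01) tC.
  apply: is_derive_line; apply: (hd _ _).1 => /=.
  exact: le_lt_trans (small_u' _ s01) tC.
have [||c c01] := @MVT R g dg 0 1 ltr01.
- move=> s; rewrite in_itv/= => /andP[s0 s1]; apply: gdg.
  by rewrite !ltW.
- apply: derivable_within_continuous => s; rewrite in_itv/= => s01.
  by have [] := gdg _ s01.
rewrite subr0 mulr1 => gE.
have {}c01 : 0 <= c <= 1.
  by move: c01; rewrite in_itv/= => /andP[? ?]; rewrite !ltW.
have hD z w : 'd ('D_u f) x (z + w) = 'd ('D_u f) x z + 'd ('D_u f) x w :> R.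
  by rewrite linearD.
have [d1 r1] := hd _ (le_lt_trans (small_uv _ c01) tC).
have [d2 r2] := hd _ (le_lt_trans (small_u' _ c01) tC).
set h1 := c *: (t *: u) + t *: v in d1 r1; set h2 := c *: (t *: u) in d2 r2.
have dh : 'd ('D_u f) x h1 = 'd ('D_u f) x h2 + t * 'D_v ('D_u f) x :> R.
  by rewrite /h1 hD -/h2 (deriveE _ dDf) [X in _ + X = _]linearZ.
have dgE : dg c = t * ('D_u f (h1 + x) - 'D_u f (h2 + x)).
  rewrite /dg addrA -/h1 -/h2 mulrBr.
  congr (_ - _).
    by rewrite (deriveE _ d1) linearZ (deriveE _ d1).
  by rewrite (deriveE _ d2) linearZ (deriveE _ d2).
have -> : f (t *: u + (t *: v + x)) - f (t *: u + x) - f (t *: v + x) + f x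
      - t * t * 'D_v ('D_u f) x
  = t * (('D_u f (h1 + x) - 'D_u f x - 'd ('D_u f) x h1) -
     ('D_u f (h2 + x) - 'D_u f x - 'd ('D_u f) x h2)).
  rewrite dh.
  transitivity (g 1 - g 0 - t * t * 'D_v ('D_u f) x).
    by rewrite /g !scale1r !scale0r !add0r; ring.
  rewrite gE dgE; ring.
rewrite normrM (gtr0_norm t0) mulrCA ler_pM2l//.
apply: (le_trans (ler_normB _ _)).
have -> : e * t = e / (2 * C) * (t * C) + e / (2 * C) * (t * C).
  by field; rewrite gt_eqF.
apply: lerD.
  apply: (le_trans r1); rewrite ler_pM2l//; exact: small_uv.
by apply: (le_trans r2); rewrite ler_pM2l//; exact: small_u'.
Unshelve. all: by end_near. Qed.

(** Symmetry of mixed derivatives: the second difference is symmetric in u and v,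
    hence t^2 D_v D_u f x and t^2 D_u D_v f x differ by o(t^2). *)
Lemma derive_swap (f : U -> R) x u v :
  (\forall y \near x, differentiable f y) ->
  differentiable ('D_u f) x -> differentiable ('D_v f) x ->
  'D_v ('D_u f) x = 'D_u ('D_v f) x.
Proof.
move=> df du dv; apply/eqP; rewrite -subr_eq0 -normr_le0; apply/ler_addgt0Pl => e e0.
rewrite addr0; have e2 : 0 < e / 2 by rewrite divr_gt0.
have [t [t0 [h1 h2]]] := filter_ex (filterI (nbhs_right_gt (0 : R)) (filterI
  (@second_difference f x u v (e / 2) df du e2)
  (@second_difference f x v u (e / 2) df dv e2))).
have tt0 : 0 < t * t by rewrite mulr_gt0.
rewrite addrCA in h2.
have tri (p q r s T a b c : R) : `|p - q - r + s - T * a| <= c ->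
    `|p - r - q + s - T * b| <= c -> `|(a - b) * T| <= c + c.
  move=> ha hb; have -> : (a - b) * T
      = (p - r - q + s - T * b) - (p - q - r + s - T * a) by ring.
  exact: le_trans (ler_normB _ _) (lerD hb ha).
rewrite -(ler_pM2r tt0) -[X in _ * X]gtr0_norm// -normrM.
have -> : e * (t * t) = e / 2 * (t * t) + e / 2 * (t * t) by field.
exact: tri h1 h2.
Qed.
End Schwarz.

(** * Stability of smoothness on an open set *)

Section SmoothOn.
Variables (R : realType) (U : normedModType R) (A : set U).
Hypothesis oA : open A.

Lemma near_open (x : U) : A x -> \forall y \near x, A y.
Proof. by move=> Ax; apply: open_nbhs_nbhs; split. Qed.

Lemma smooth_on_differentiable (V : normedModType R) (f : U -> V) x :
  smooth_on A f -> A x -> differentiable f x.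
Proof. by move=> sf Ax; exact: (sf [::]). Qed.

Lemma smooth_on_near_differentiable (V : normedModType R) (f : U -> V) x :
  smooth_on A f -> A x -> \forall y \near x, differentiable f y.
Proof.
move=> sf Ax; apply: filterS (near_open Ax) => y; exact: smooth_on_differentiable.
Qed.

Lemma smooth_on_derive (V : normedModType R) (f : U -> V) v :
  smooth_on A f -> smooth_on A ('D_v f).
Proof. by move=> sf s x Ax; have := sf (rcons s v) x Ax; rewrite foldr_rcons. Qed.

Lemma foldr_derive_eq_on (V : normedModType R) (f g : U -> V) s :
  (forall x, A x -> f x = g x) ->
  forall x, A x -> foldr (fun v h => 'D_v h) f s x = foldr (fun v h => 'D_v h) g s x.
Proof.
move=> fg; elim: s => [//|v s IH] x Ax /=.
by apply: near_eq_derive; apply: filterS (near_open Ax) => y; exact: IH.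
Qed.

(** Smoothness by coinduction: it suffices to find a class of differentiable functions
    that contains f and is stable, up to equality on A, under directional derivatives. *)
Lemma smooth_on_closed (V : normedModType R) (P : (U -> V) -> Prop) :
  (forall f, P f -> forall x, A x -> differentiable f x) ->
  (forall f v, P f -> exists2 g, P g & forall x, A x -> 'D_v f x = g x) ->
  forall f, P f -> smooth_on A f.
Proof.
move=> Pdiff Pder f Pf s; elim/last_ind: s f Pf => [|s v IH] f Pf x Ax.
  exact: Pdiff Pf x Ax.
rewrite foldr_rcons; have [g Pg fg] := Pder f v Pf.
apply: near_differentiable (IH g Pg x Ax).
by apply: filterS (near_open Ax) => y Ay; rewrite (foldr_derive_eq_on _ fg).
Qed.

Lemma smooth_on_eq (V : normedModType R) (f g : U -> V) :
  (forall x, A x -> f x = g x) -> smooth_on A f -> smooth_on A g.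
Proof.
move=> fg sf s x Ax; apply: near_differentiable (sf s x Ax).
by apply: filterS (near_open Ax) => y; exact: foldr_derive_eq_on.
Qed.

(** The algebra generated by the smooth functions.  Unlike the class of products of two
    smooth functions, it is stable under directional derivatives, so that sums and
    products are treated together. *)
Inductive smooth_alg : (U -> R) -> Prop :=
| SmoothBase f : smooth_on A f -> smooth_alg f
| SmoothAdd f g : smooth_alg f -> smooth_alg g -> smooth_alg (f + g)
| SmoothMul f g : smooth_alg f -> smooth_alg g -> smooth_alg (f * g).

Lemma smooth_on_alg f : smooth_alg f -> smooth_on A f.
Proof.
have Pdiff h : smooth_alg h -> forall x, A x -> differentiable h x.
  elim=> {h} [h sh|h g _ IHh _ IHg|h g _ IHh _ IHg] x Ax.
  - exact: smooth_on_differentiable.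
  - exact: differentiableD (IHh x Ax) (IHg x Ax).
  - exact: differentiableM (IHh x Ax) (IHg x Ax).
apply: smooth_on_closed => // {}f v; elim=> {f} [h sh|h g Ph [h' Ph' hE] Pg [g' Pg' gE]|h g Ph [h' Ph' hE] Pg [g' Pg' gE]].
- by exists ('D_v h) => //; apply: SmoothBase; exact: smooth_on_derive.
- exists (h' + g'); first exact: SmoothAdd.
  move=> x Ax; rewrite deriveD ?hE ?gE//; apply: diff_derivable; exact: Pdiff.
- exists (h * g' + g * h'); first by apply: SmoothAdd; exact: SmoothMul.
  by move=> x Ax; rewrite deriveM ?hE ?gE//; apply: diff_derivable; exact: Pdiff.
Qed.

Lemma smooth_onB (f g : U -> R) :
  smooth_on A f -> smooth_on A g -> smooth_on A (f - g).
Proof.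
move=> sf sg.
have : smooth_on A (f + (fun=> -1) * g).
  apply: smooth_on_alg; apply: SmoothAdd; first exact: SmoothBase.
  apply: SmoothMul; last exact: SmoothBase.
  apply: SmoothBase; apply: (@smooth_on_closed _ (fun h => exists c, h = cst c)).
  + by move=> _ [c ->] x _; exact: differentiable_cst.
  + by move=> _ v [c ->]; exists (cst 0) => [|x _]; [exists 0|rewrite derive_cst].
  + by exists (-1).
by apply: smooth_on_eq => x _; rewrite -![(_ + _ : _ -> _) _]/(_ + _) -![(_ * _ : _ -> _) _]/(_ * _) mulN1r.
Qed.

Lemma smooth_on_sum (I : Type) (r : seq I) (F : I -> U -> R) :
  (forall i, smooth_on A (F i)) -> smooth_on A (\sum_(i <- r) F i).
Proof.
move=> sF; elim: r => [|i r IH].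
  rewrite big_nil; apply: (@smooth_on_closed _ (fun h => h = 0)) => //.
  + by move=> _ -> x _; exact: (@differentiable_cst _ _ _ (0 : R)).
  + by move=> _ v ->; exists 0 => // x _; rewrite (derive_cst (0 : R)).
by rewrite big_cons; apply: smooth_on_alg; apply: SmoothAdd; exact: SmoothBase.
Qed.

Lemma smooth_on_entry m n (F : U -> 'M[R]_(m, n)) i j :
  smooth_on A F -> smooth_on A (fun x => F x i j).
Proof.
move=> sF; apply: (@smooth_on_closed _
  (fun h => exists2 G : U -> 'M[R]_(m, n), smooth_on A G & h = fun x => G x i j)).
- move=> _ [G sG ->] x Ax; apply: differentiable_entry.
  exact: smooth_on_differentiable sG Ax.
- move=> _ v [G sG ->]; exists (fun x => 'D_v G x i j).
    by exists ('D_v G) => //; exact: smooth_on_derive.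
  by move=> x Ax; rewrite derive_entry//; exact: smooth_on_differentiable sG Ax.
- by exists F.
Qed.

Lemma smooth_on_mx m n (F : 'I_m -> 'I_n -> U -> R) :
  (forall i j, smooth_on A (F i j)) -> smooth_on A (fun x => \matrix_(i, j) F i j x).
Proof.
have Gd (G : 'I_m -> 'I_n -> U -> R) x : (forall i j, smooth_on A (G i j)) -> A x ->
    differentiable (fun x => \matrix_(i, j) G i j x) x.
  move=> sG Ax; apply: differentiable_mx => i j.
  rewrite (_ : (fun _ => _) = G i j); first exact: smooth_on_differentiable (sG i j) Ax.
  by apply/funext => y; rewrite mxE.
move=> sF; apply: (@smooth_on_closed _
  (fun H => exists2 G : 'I_m -> 'I_n -> U -> R, (forall i j, smooth_on A (G i j))
     & H = fun x => \matrix_(i, j) G i j x)).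
- by move=> _ [G sG ->] x Ax; exact: Gd.
- move=> _ v [G sG ->]; exists (fun x => \matrix_(i, j) 'D_v (G i j) x).
    by exists (fun i j => 'D_v (G i j)) => // i j; exact: smooth_on_derive.
  move=> x Ax; apply/matrixP => i j; rewrite -derive_entry; last exact: Gd.
  have GE : (fun y => (\matrix_(i, j) G i j y) i j) = G i j.
    by apply/funext => y; rewrite mxE.
  by rewrite GE mxE.
- by exists F.
Qed.

Lemma smooth_on_pairing m (W : U -> 'rV[R]_m -> R) (S : U -> 'rV[R]_m) :
  (forall x, A x -> scalar (W x)) -> (forall e, smooth_on A (W^~ e)) ->
  smooth_on A S -> smooth_on A (fun x => W x (S x)).
Proof.
move=> linW sW sS.
have : smooth_on A (\sum_(i < m) (fun x => S x 0 i) * W^~ (delta_mx 0 i)).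
  apply: smooth_on_sum => i; apply: smooth_on_alg; apply: SmoothMul; apply: SmoothBase => //.
  exact: smooth_on_entry.
apply: smooth_on_eq => x Ax; rewrite (scalar_row_delta _ (linW _ Ax)).
by rewrite fct_sumE.
Qed.

End SmoothOn.

(** * Charts and tangent vectors *)

Definition transition (R : realType) m (N : charted R m) (c c' : idx N) :
  'rV[R]_m -> 'rV[R]_m := phi c' \o psi c.

Definition overlap (R : realType) m (N : charted R m) (c c' : idx N) :
  set 'rV[R]_m := tgt c `&` psi c @^-1` dom c'.

(** The part of the manifold axioms that the calculus of tangent vectors uses.  The
    changes of charts need only be differentiable, which on the k-tangent bundle takes
    no more than two derivatives of those of M. *)
Record c1_atlas (R : realType) m (N : charted R m) : Prop := C1Atlas {
  atlas_chart_at : forall p : N, dom (chart_at p) p;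
  atlas_phi : forall (c : idx N) p, dom c p -> tgt c (phi c p);
  atlas_psi : forall (c : idx N) x, tgt c x -> dom c (psi c x);
  atlas_phiK : forall (c : idx N) p, dom c p -> psi c (phi c p) = p;
  atlas_psiK : forall (c : idx N) x, tgt c x -> phi c (psi c x) = x;
  atlas_open : forall c : idx N, open (tgt c);
  atlas_overlap : forall c c' : idx N, open (overlap c c');
  atlas_transition : forall (c c' : idx N) x,
    overlap c c' x -> differentiable (transition c c') x }.

Arguments atlas_chart_at {R m N} _ p.
Arguments atlas_open {R m N} _ c.
Arguments atlas_overlap {R m N} _ c c'.

Lemma manifold_c1_atlas (R : realType) m (N : charted R m) :
  is_manifold N -> c1_atlas N.
Proof.
case=> ? ? ? ? ? ? ? sT _ _; split => // c c' x cx.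
exact: smooth_on_differentiable (sT c c') cx.
Qed.

Section Charts.
Variables (R : realType) (m : nat) (N : charted R m).
Hypothesis aN : c1_atlas N.
Implicit Types (c : idx N) (p : N).

Lemma overlap_phi c c' p : dom c p -> dom c' p -> overlap c c' (phi c p).
Proof.
by move=> cp c'p; split; [exact: atlas_phi|rewrite /= atlas_phiK].
Qed.

Lemma overlap_transition c c' c'' x : overlap c c' x -> dom c'' (psi c x) ->
  overlap c' c'' (transition c c' x).
Proof. by move=> [_ c'x] c''x; exact: overlap_phi. Qed.

Lemma transition_phi c c' p : dom c p -> transition c c' (phi c p) = phi c' p.
Proof. by move=> cp; rewrite /transition /= atlas_phiK. Qed.

(** The chain rule for the changes of charts; all relations between coordinates of a
    tangent vector in different charts are instances of it. *)
Lemma transition_cocycle c c' c'' x v : overlap c c' x -> overlap c c'' x ->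
  'D_('D_v (transition c c') x) (transition c' c'') (transition c c' x)
  = 'D_v (transition c c'') x.
Proof.
move=> o' o''; rewrite -derive_comp; first last.
- by apply: (atlas_transition aN); apply: overlap_transition o' _; case: o''.
- exact: (atlas_transition aN).
apply: near_eq_derive; apply: filterS (near_open (atlas_overlap aN c c') o').
by move=> y [_ cy]; rewrite /transition /= atlas_phiK.
Qed.

Lemma transition_id c x v : tgt c x -> 'D_v (transition c c) x = v.
Proof.
move=> cx; rewrite -[RHS](derive_id x v).
apply: near_eq_derive; apply: filterS (near_open (atlas_open aN c) cx) => y cy.
by rewrite /transition /= atlas_psiK.
Qed.

Lemma from_chart_to_chart c c' p u : dom c p -> dom c' p ->
  to_chart c' p (from_chart c p u) = 'D_u (transition c c') (phi c p).
Proof.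
move=> cp c'p.
have cat := atlas_chart_at aN p.
rewrite -(@transition_cocycle c (chart_at p)); [|exact: overlap_phi..].
by rewrite transition_phi.
Qed.

Lemma from_chartK c p : dom c p -> cancel (from_chart c p) (to_chart c p).
Proof.
move=> cp u; rewrite from_chart_to_chart// transition_id//.
exact: atlas_phi.
Qed.

Lemma to_chartK c p : dom c p -> cancel (to_chart c p) (from_chart c p).
Proof.
move=> cp v; have cat := atlas_chart_at aN p.
have := @transition_cocycle (chart_at p) c (chart_at p) (phi (chart_at p) p) v
  (overlap_phi cat cp) (overlap_phi cat cat).
rewrite transition_id; last exact: atlas_phi.
by rewrite transition_phi.
Qed.

Lemma to_chart_id p v : to_chart (chart_at p) p v = v.
Proof. by apply: transition_id; apply: atlas_phi => //; exact: atlas_chart_at. Qed.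

Lemma vf_rep_id (X : vfield N) p : vf_rep (chart_at p) X (phi (chart_at p) p) = X p.
Proof.
rewrite /vf_rep atlas_phiK//; first exact: to_chart_id.
exact: atlas_chart_at.
Qed.

End Charts.

(** * Prolongation to k-velocities *)

Section Prolongation.
Variables (R : realType) (n k : nat).
Implicit Types (f : 'rV[R]_n -> 'rV[R]_n) (y u : 'rV[R]_(n + k * n)).

Definition velocity y (A : 'I_k) : 'rV[R]_n := row A (vec_mx (rsubmx y)).

(** The map induced by f on k-velocities, in natural coordinates. *)
Definition prolong f y : 'rV[R]_(n + k * n) :=
  row_mx (f (lsubmx y)) (mxvec (\matrix_(A < k) 'D_(velocity y A) f (lsubmx y))).

(** The vertical vector with A-th component w.  In natural coordinates the k-tangent
    structure is S^A u = vlift A (lsubmx u). *)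
Definition vlift (A : 'I_k) (w : 'rV[R]_n) : 'rV[R]_(n + k * n) :=
  \sum_(i < n) w 0 i *: ddv R A i.

Lemma vlift_linear A : linear (vlift A).
Proof.
move=> a u v; rewrite /vlift scaler_sumr -big_split; apply: eq_bigr => i _ /=.
by rewrite !mxE scalerDl scalerA.
Qed.

Lemma vliftE A w : vlift A w = row_mx 0 (mxvec (\matrix_(B < k) ((B == A)%:R *: w))).
Proof.
rewrite /vlift /ddv.
transitivity (row_mx 0 (mxvec (\sum_(i < n) w 0 i *: delta_mx A i)) : 'rV[R]_(n + k * n)).
  rewrite linear_sum.
  elim/big_ind2 : _ => [|x x' y y' -> ->|i _]; first by rewrite row_mx0.
    by rewrite add_row_mx addr0.
  by rewrite scale_row_mx scaler0 linearZ.
congr (row_mx _ (mxvec _)); apply/matrixP => B j; rewrite summxE !mxE.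
rewrite (bigD1 j)//= big1 ?addr0 => [|i ij]; rewrite !mxE.
  by rewrite eqxx andbT mulrC.
by rewrite [j == i]eq_sym (negbTE ij) andbF mulr0.
Qed.

Lemma lsubmx_vlift A w : lsubmx (vlift A w) = 0.
Proof. by rewrite vliftE row_mxKl. Qed.

Lemma derive_lsubmx_prolong f y u :
  differentiable (prolong f) y -> differentiable f (lsubmx y) ->
  lsubmx ('D_u (prolong f) y) = 'D_(lsubmx u) f (lsubmx y).
Proof.
move=> dp df.
have dl z w : 'D_w (lsubmx : 'rV[R]_(n + k * n) -> 'rV[R]_n) z = lsubmx w.
  exact: derive_linear.
rewrite -(dl (prolong f y) ('D_u (prolong f) y)) -(dl y u).
rewrite -(derive_comp u dp (differentiable_lsubmx _)).
rewrite -(@derive_comp _ _ _ _ lsubmx f y u (differentiable_lsubmx _) df).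
have -> // : lsubmx \o prolong f = f \o lsubmx.
by apply/funext => z; rewrite /= row_mxKl.
Qed.

(** On a fibre, the prolongation of f is the linear map D f acting on each velocity, so
    it is its own derivative in vertical directions.  With the preceding lemma this
    says that prolongations commute with the k-tangent structure. *)
Lemma derive_vlift_prolong f y A w : differentiable f (lsubmx y) ->
  'D_(vlift A w) (prolong f) y = vlift A ('D_w f (lsubmx y)).
Proof.
move=> df; apply: derive_affine => h.
have lE : lsubmx (h *: vlift A w + y) = lsubmx y.
  by rewrite linearP /= lsubmx_vlift scaler0 add0r.
rewrite [in LHS]/prolong lE [in RHS]/prolong [in RHS]vliftE scale_row_mx scaler0 add_row_mx add0r.
congr row_mx; rewrite -linearZ -linearD; congr mxvec.
apply/row_matrixP => B; rewrite rowK [RHS]linearP /= !rowK.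
have -> : velocity (h *: vlift A w + y) B = (h * (B == A)%:R) *: w + velocity y B.
  rewrite /velocity vliftE linearP /= row_mxKr [vec_mx _]linearP /= mxvecK.
  by rewrite linearP /= rowK scalerA.
by rewrite (derive_dirP df) scalerA.
Qed.

Lemma differentiable_prolong f y :
  (\forall x \near lsubmx y, differentiable f x) ->
  (forall v, differentiable ('D_v f) (lsubmx y)) -> differentiable (prolong f) y.
Proof.
move=> df dDf; apply: differentiable_mx => i j; rewrite ord1 {i}.
have dl : differentiable (lsubmx : 'rV[R]_(n + k * n) -> 'rV[R]_n) y.
  exact: differentiable_lsubmx.
rewrite -(splitK j); case: (fintype.split j) => {}j /=.
  rewrite (_ : (fun _ => _) = (fun x => f x 0 j) \o lsubmx); last first.
    by apply/funext => z /=; rewrite row_mxEl.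
  apply: differentiable_comp => //.
  by apply: differentiable_entry; exact: nbhs_singleton df.
case/mxvec_indexP: j => A j.
have dfl : \forall z \near y, differentiable f (lsubmx z).
  exact: (differentiable_continuous dl) df.
apply: (@near_differentiable _ _ _ (\sum_(i < n)
  (fun z => velocity z A 0 i) * (fun z => 'D_(delta_mx 0 i) f (lsubmx z) 0 j))).
  apply: filterS dfl => z dz; rewrite row_mxEr mxvecE mxE.
  rewrite (@scalar_row_delta _ _ (fun w => 'D_w f (lsubmx z) 0 j)).
    by rewrite fct_sumE.
  by move=> a u v; rewrite (derive_dirP dz) !mxE.
apply: differentiable_sum => i; apply: differentiableM.
  rewrite (_ : (fun _ => _) = (fun w => w 0 (mxvec_index A i)) \o rsubmx); last first.
    by apply/funext => z /=; rewrite !mxE.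
  exact: (differentiable_comp (differentiable_rsubmx y)
    (differentiable_coord (rsubmx y) 0 (mxvec_index A i))).
rewrite (_ : (fun _ => _) = (fun x => 'D_(delta_mx 0 i) f x 0 j) \o lsubmx)//.
by apply: differentiable_comp => //; exact: differentiable_entry.
Qed.

End Prolongation.

(** * The Lagrangian forms in coordinates *)

Lemma smooth_on_swap (R : realType) (U : normedModType R) (A : set U) m n
    (f : U -> 'M[R]_(m, n)) x u v :
  open A -> smooth_on A f -> A x -> 'D_v ('D_u f) x = 'D_u ('D_v f) x.
Proof.
move=> oA sf Ax; apply/matrixP => i j.
have dd w : differentiable ('D_w f) x.
  exact: smooth_on_differentiable (smooth_on_derive _ sf) Ax.
have sfij := smooth_on_entry oA i j sf.
have dij w z : 'D_z ('D_w f) x i j = 'D_z ('D_w (fun y => f y i j)) x.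
  rewrite -(derive_entry z i j (dd w)).
  apply: near_eq_derive; apply: filterS (near_open oA Ax) => y Ay.
  by rewrite derive_entry//; exact: smooth_on_differentiable sf Ay.
refine (etrans (dij u v) (etrans _ (esym (dij v u)))).
apply: derive_swap.
- exact: smooth_on_near_differentiable sfij Ax.
- exact: smooth_on_differentiable (smooth_on_derive _ sfij) Ax.
- exact: smooth_on_differentiable (smooth_on_derive _ sfij) Ax.
Qed.

Section OmegaLoc.
Variables (R : realType) (n k : nat).
Implicit Types (y u v : 'rV[R]_(n + k * n)) (A : 'I_k).

(** The coordinate expression of - d theta, for theta_u = D_(vlift A (lsubmx u)) f.  In the
    basis of coordinate vectors these components of theta are constant combinations of
    the df/dv_A^i, hence the absence of terms that differentiate vlift. *)
Definition omega_loc A (f : 'rV[R]_(n + k * n) -> R) y u v : R :=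
  'D_v ('D_(vlift A (lsubmx u)) f) y - 'D_u ('D_(vlift A (lsubmx v)) f) y.

Lemma omega_loc_eq (T : set 'rV[R]_(n + k * n)) A f g y u v :
  open T -> (forall z, T z -> f z = g z) -> T y ->
  omega_loc A f y u v = omega_loc A g y u v.
Proof.
move=> oT fg Ty.
have E a b : 'D_a ('D_b f) y = 'D_a ('D_b g) y.
  exact: (foldr_derive_eq_on oT [:: a; b] fg Ty).
exact: (congr2 (fun a b => a - b) (E _ _) (E _ _)).
Qed.

Lemma omega_loc_alt A f y u : omega_loc A f y u u = 0.
Proof. by rewrite /omega_loc subrr. Qed.

Lemma derive_vlift_linear A (f : 'rV[R]_(n + k * n) -> R) y :
  differentiable f y -> scalar (fun w => 'D_(vlift A w) f y).
Proof. by move=> df a u v; rewrite vlift_linear (derive_dirP df). Qed.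

Section Bilinear.
Variables (T : set 'rV[R]_(n + k * n)) (A : 'I_k) (f : 'rV[R]_(n + k * n) -> R).
Hypotheses (oT : open T) (sf : smooth_on T f).

Lemma omega_loc_swap y u v : omega_loc A f y u v = - omega_loc A f y v u.
Proof. by rewrite /omega_loc opprB. Qed.

Lemma omega_loc_linear_r y u : T y -> scalar (omega_loc A f y u).
Proof.
move=> Ty a v w.
have dd z : differentiable ('D_z f) y.
  exact: smooth_on_differentiable (smooth_on_derive _ sf) Ty.
have E1 : 'D_u ('D_(vlift A (lsubmx (a *: v + w))) f) y =
    a * 'D_u ('D_(vlift A (lsubmx v)) f) y + 'D_u ('D_(vlift A (lsubmx w)) f) y.
  transitivity ('D_u (a *: 'D_(vlift A (lsubmx v)) f + 'D_(vlift A (lsubmx w)) f) y).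
    apply: near_eq_derive; apply: filterS (near_open oT Ty) => z Tz.
    rewrite linearP /= vlift_linear.
    by rewrite (derive_dirP (smooth_on_differentiable sf Tz)).
  rewrite deriveD ?deriveZ//; [exact: diff_derivable..| |exact: diff_derivable].
  by apply: derivableZ; exact: diff_derivable.
have E2 := derive_dirP (dd (vlift A (lsubmx u))) a v w.
have alg (x x' z z' : R) : (a * x + x') - (a * z + z') = a * (x - z) + (x' - z').
  by ring.
exact: (etrans (congr2 (fun b c => b - c) E2 E1) (alg _ _ _ _)).
Qed.

Lemma omega_loc_linear_l y v : T y -> scalar (omega_loc A f y ^~ v).
Proof.
move=> Ty a u w.
have alg (x z : R) : - (a * x + z) = a * - x + - z by ring.
have sw z : omega_loc A f y z v = - omega_loc A f y v z by exact: omega_loc_swap.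
exact: (etrans (sw _) (etrans (congr1 -%R (omega_loc_linear_r v Ty a u w))
  (etrans (alg _ _) (congr2 (fun b c => a * b + c) (esym (sw u)) (esym (sw w)))))).
Qed.

Lemma smooth_on_omega_loc u v : smooth_on T (fun y => omega_loc A f y u v).
Proof. by apply: smooth_onB => //; do 2!apply: smooth_on_derive. Qed.

End Bilinear.

Lemma smooth_on_prolong (B : set 'rV[R]_n) (tau : 'rV[R]_n -> 'rV[R]_n) y :
  open B -> smooth_on B tau -> B (lsubmx y) -> differentiable (prolong tau) y.
Proof.
move=> oB st By; apply: differentiable_prolong.
  exact: smooth_on_near_differentiable st By.
by move=> v; exact: smooth_on_differentiable (smooth_on_derive _ st) By.
Qed.

(** By the chain rule and the intertwining property,
    D_(K b) (f o P) = D_(vlift A (D_b tau)) f o P, with P the prolongation of tau.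
    Differentiating this along a, the Leibniz rule yields the transformed term plus
    D_(vlift A (D_a D_b tau)) f o P, which is symmetric in a and b and disappears in
    the antisymmetrisation.  Derivatives of tau are along the base parts of a and b. *)
Lemma omega_loc_prolong (B : set 'rV[R]_n) (T : set 'rV[R]_(n + k * n)) A tau f y u v :
  open B -> open T -> smooth_on B tau -> smooth_on T f ->
  B (lsubmx y) -> T (prolong tau y) ->
  omega_loc A (f \o prolong tau) y u v =
  omega_loc A f (prolong tau y) ('D_u (prolong tau) y) ('D_v (prolong tau) y).
Proof.
move=> oB oT st sf By Ty.
have dl z : differentiable (lsubmx : 'rV[R]_(n + k * n) -> 'rV[R]_n) z.
  exact: differentiable_lsubmx.
have dp := smooth_on_prolong oB st By.
have dt := smooth_on_differentiable st By.
have nB : \forall z \near y, B (lsubmx z).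
  exact: (differentiable_continuous (dl y)) (near_open oB By).
have nT : \forall z \near y, T (prolong tau z).
  exact: (differentiable_continuous dp) (near_open oT Ty).
have key a b : 'D_a ('D_(vlift A (lsubmx b)) (f \o prolong tau)) y =
    'D_('D_a (prolong tau) y) ('D_(vlift A (lsubmx ('D_b (prolong tau) y))) f) (prolong tau y)
    + 'D_(vlift A ('D_(lsubmx a) ('D_(lsubmx b) tau) (lsubmx y))) f (prolong tau y).
  pose S (z : 'rV[R]_(n + k * n)) := 'D_(lsubmx b) tau (lsubmx z).
  pose W (z : 'rV[R]_(n + k * n)) e := 'D_(vlift A e) f (prolong tau z).
  have dDt : differentiable ('D_(lsubmx b) tau) (lsubmx y).
    exact: smooth_on_differentiable (smooth_on_derive _ st) By.
  transitivity ('D_a (fun z => W z (S z)) y).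
    apply: near_eq_derive; apply: filterS2 nB nT => z Bz Tz.
    rewrite derive_comp; last 2 first.
    - exact: smooth_on_prolong st Bz.
    - exact: smooth_on_differentiable sf Tz.
    by rewrite (derive_vlift_prolong A _ (smooth_on_differentiable st Bz)).
  have dW e : differentiable ('D_(vlift A e) f) (prolong tau y).
    exact: smooth_on_differentiable (smooth_on_derive _ sf) Ty.
  rewrite derive_pairing; last 3 first.
  - apply: filterS nT => z Tz; apply: derive_vlift_linear.
    exact: smooth_on_differentiable sf Tz.
  - by move=> e; exact: (differentiable_comp dp (dW e)).
  - exact: (differentiable_comp (dl y) dDt).
  have E1 : 'D_a (W^~ (S y)) y = 'D_('D_a (prolong tau) y)
      ('D_(vlift A (lsubmx ('D_b (prolong tau) y))) f) (prolong tau y).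
    have lE := derive_lsubmx_prolong b dp dt.
    exact: (etrans (derive_comp a dp (dW (S y))) (congr1 (fun w =>
      'D_('D_a (prolong tau) y) ('D_(vlift A w) f) (prolong tau y)) (esym lE))).
  have E2 : 'D_a S y = 'D_(lsubmx a) ('D_(lsubmx b) tau) (lsubmx y).
    rewrite (derive_comp a (dl y) dDt).
    by rewrite (@derive_linear _ _ _ lsubmx).
  exact: (congr2 +%R E1 (congr1 (W y) E2)).
have alg (x x' z : R) : (x + z) - (x' + z) = x - x' by ring.
have sw := congr1 (fun w => 'D_(vlift A w) f (prolong tau y))
  (smooth_on_swap (lsubmx u) (lsubmx v) oB st By).
exact: (etrans (congr2 (fun b c => b - c)
  (etrans (key v u) (congr1 (+%R _) sw)) (key u v)) (alg _ _ _)).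
Qed.

End OmegaLoc.

(** * The Lagrangian forms on the k-tangent bundle *)

Section TangentAtlas.
Variables (R : realType) (n k : nat) (M : charted R n).
Hypothesis hM : is_manifold M.
Local Notation TkM := (Tk1 k M).
Let aM := manifold_c1_atlas hM.
Implicit Types (c : idx TkM) (y : 'rV[R]_(n + k * n)).

(** The coordinates of a velocity in two charts of M differ by the derivative of the change
    of charts. *)
Lemma Tk1_transition c c' y : @overlap R _ TkM c c' y ->
  prolong (@transition R n M c c') y = @transition R _ TkM c c' y.
Proof.
move=> [cy c'y]; rewrite /transition /=; congr (row_mx _ (mxvec _)).
apply/row_matrixP => A; rewrite !rowK.
have dp : dom (c : idx M) (psi (c : idx M) (lsubmx y)) by exact: atlas_psi.
by rewrite (from_chart_to_chart aM)// atlas_psiK.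
Qed.

Lemma Tk1_tgt_open c : open (@tgt R _ TkM c).
Proof.
apply: (@open_comp _ _ (lsubmx : 'rV[R]_(n + k * n) -> 'rV[R]_n)).
  by move=> y _; exact: differentiable_continuous (differentiable_lsubmx y).
exact: (atlas_open aM).
Qed.

Arguments Tk1_tgt_open : clear implicits.

Lemma Tk1_overlap_open c c' : open (@overlap R _ TkM c c').
Proof.
apply: (@open_comp _ _ (lsubmx : 'rV[R]_(n + k * n) -> 'rV[R]_n)
  (@overlap R n M c c')).
  by move=> y _; exact: differentiable_continuous (differentiable_lsubmx y).
exact: (atlas_overlap aM).
Qed.

Arguments Tk1_overlap_open : clear implicits.

Lemma transition_smooth (c c' : idx M) : smooth_on (overlap c c') (transition c c').
Proof. exact: mfd_transition. Qed.

Lemma Tk1_c1_atlas : c1_atlas TkM.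
Proof.
split.
- by move=> q; exact: (atlas_chart_at aM).
- by move=> c q cq; rewrite /tgt /= row_mxKl; exact: atlas_phi.
- by move=> c y cy; exact: (atlas_psi aM).
- move=> c [p w] /= cp; rewrite row_mxKl row_mxKr mxvecK atlas_phiK//; congr pair.
  by apply/row_matrixP => A; rewrite !rowK (to_chartK aM).
- move=> c y cy; have cp := atlas_psi aM cy.
  rewrite /= (atlas_psiK aM cy) -[RHS]hsubmxK; congr row_mx.
  rewrite -[RHS]vec_mxK; congr mxvec.
  by apply/row_matrixP => A; rewrite !rowK (from_chartK aM).
- exact: Tk1_tgt_open.
- exact: Tk1_overlap_open.
- move=> c c' y cy.
  apply: (@near_differentiable _ _ _ (prolong (@transition R n M c c'))).
    by apply: filterS (near_open (Tk1_overlap_open c c') cy) => z; exact: Tk1_transition.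
  exact: (smooth_on_prolong (atlas_overlap aM c c') (@transition_smooth c c')).
Qed.

Variable L : TkM -> R.
Hypothesis hL : smooth_map L.
Variable A : 'I_k.

Lemma local_lagrangian_prolong c c' y : @overlap R _ TkM c c' y ->
  L (psi c y) = (L \o psi c' \o prolong (@transition R n M c c')) y.
Proof.
move=> cy; have E : psi c' (@transition R _ TkM c c' y) = psi c y.
  by apply: (atlas_phiK Tk1_c1_atlas); case: cy.
by rewrite -E -(Tk1_transition cy).
Qed.

Section Point.
Variables (c : idx TkM) (y : 'rV[R]_(n + k * n)).
Hypothesis cy : tgt c y.
Let q : TkM := psi c y.
Let c' := chart_at q.
Let tau := @transition R n M c c'.

Lemma overlap_chart_at : @overlap R _ TkM c c' y.
Proof. by split => //; exact: (atlas_chart_at Tk1_c1_atlas). Qed.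

Lemma from_chart_prolong u : from_chart c q u = 'D_u (prolong tau) y.
Proof.
rewrite /from_chart (atlas_psiK Tk1_c1_atlas cy).
apply: near_eq_derive.
apply: filterS (near_open (Tk1_overlap_open c c') overlap_chart_at) => z cz.
by rewrite (Tk1_transition cz).
Qed.

Lemma prolong_chart_at : prolong tau y = phi c' q.
Proof. exact: Tk1_transition overlap_chart_at. Qed.

(** In the chart attached to the point this is the definition of theta; invariance of the
    k-tangent structure under prolongations carries it over to any other chart. *)
Lemma theta_L_rep u :
  form1_rep c (theta_L L A) y u = 'D_(vlift A (lsubmx u)) (L \o psi c) y.
Proof.
have oy := overlap_chart_at.
have st := @transition_smooth c c'.
have oB := atlas_overlap aM c c'.
have dp := smooth_on_prolong oB st oy.
have dt := smooth_on_differentiable st oy.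
have ty : tgt c' (prolong tau y).
  rewrite prolong_chart_at; apply: (atlas_phi Tk1_c1_atlas).
  exact: (atlas_chart_at Tk1_c1_atlas).
have dL := smooth_on_differentiable (@hL c') ty.
have -> : 'D_(vlift A (lsubmx u)) (L \o psi c) y =
    'D_(vlift A (lsubmx u)) ((L \o psi c') \o prolong tau) y.
  apply: near_eq_derive.
  apply: filterS (near_open (Tk1_overlap_open c c') oy) => z cz.
  exact: local_lagrangian_prolong.
transitivity ('D_(vlift A ('D_(lsubmx u) tau (lsubmx y))) (L \o psi c') (prolong tau y)).
  by rewrite prolong_chart_at -(derive_lsubmx_prolong u dp dt) -from_chart_prolong.
rewrite -(derive_vlift_prolong A (lsubmx u) dt).
exact: (esym (derive_comp (vlift A (lsubmx u)) dp dL)).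
Qed.

End Point.

Lemma omega_L_chart_at (q : TkM) u v :
  omega_L L A q u v = omega_loc A (L \o psi (chart_at q)) (phi (chart_at q) q) u v.
Proof.
have cq : tgt (chart_at q) (phi (chart_at q) q).
  apply: (atlas_phi Tk1_c1_atlas); exact: (atlas_chart_at Tk1_c1_atlas).
have E w z : 'D_w (fun x => form1_rep (chart_at q) (theta_L L A) x z)
      (phi (chart_at q) q) =
    'D_w ('D_(vlift A (lsubmx z)) (L \o psi (chart_at q))) (phi (chart_at q) q).
  apply: near_eq_derive; apply: filterS (near_open (Tk1_tgt_open _) cq) => x cx.
  exact: theta_L_rep.
exact: (etrans (congr1 -%R (congr2 (fun a b => a - b) (E u v) (E v u))) (opprB _ _)).
Qed.

(** The preceding lemma gives omega at each point in the chart attached to that point;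
    here the chart c is the same for all points y, which is what differentiation and
    smoothness require. *)
Lemma omega_L_rep c y u v : tgt c y ->
  form2_rep c (omega_L L A) y u v = omega_loc A (L \o psi c) y u v.
Proof.
move=> cy; have oy := overlap_chart_at cy.
set c' := chart_at _ in oy.
have ty : tgt c' (prolong (@transition R n M c c') y).
  rewrite (prolong_chart_at cy); apply: (atlas_phi Tk1_c1_atlas).
  exact: (atlas_chart_at Tk1_c1_atlas).
have E1 := omega_L_chart_at (psi c y) (from_chart c (psi c y) u) (from_chart c (psi c y) v).
have E2 := f_equal3 (omega_loc A (L \o psi c')) (esym (prolong_chart_at cy))
  (from_chart_prolong cy u) (from_chart_prolong cy v).
have E3 := omega_loc_eq A u v (Tk1_overlap_open c c') (@local_lagrangian_prolong c c') oy.
have E4 := omega_loc_prolong A u v (atlas_overlap aM c c') (Tk1_tgt_open c')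
  (@transition_smooth c c') (@hL c') oy ty.
exact: (etrans E1 (etrans E2 (etrans (esym E4) (esym E3)))).
Qed.

Section Contraction.
Variables (S Y : vfield TkM).
Hypotheses (hS : smooth_vf S) (hY : smooth_vf Y).
Let Phi (q : TkM) := omega_L L A q (S q) (Y q).

Lemma contraction_rep c y : tgt c y ->
  Phi (psi c y) = omega_loc A (L \o psi c) y (vf_rep c S y) (vf_rep c Y y).
Proof.
move=> cy.
have K := to_chartK Tk1_c1_atlas (atlas_psi Tk1_c1_atlas cy).
exact: (etrans (congr2 (omega_L L A (psi c y)) (esym (K _)) (esym (K _)))
  (omega_L_rep (vf_rep c S y) (vf_rep c Y y) cy)).
Qed.

Lemma smooth_contraction : smooth_map Phi.
Proof.
move=> c; apply: (smooth_on_eq (Tk1_tgt_open c)) => [y cy|].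
  exact/esym/contraction_rep.
have oc := Tk1_tgt_open c; pose w := omega_loc A (L \o psi c).
have sw u v : smooth_on (@tgt R _ TkM c) (fun y => w y u v).
  exact: (smooth_on_omega_loc A oc (@hL c)).
have sl v : smooth_on (@tgt R _ TkM c) (fun y => w y (vf_rep c S y) v).
  apply: (@smooth_on_pairing _ _ _ oc _ (fun y u => w y u v)); [|by []|exact: hS].
  by move=> y cy; exact: (omega_loc_linear_l A oc (@hL c)).
apply: (@smooth_on_pairing _ _ _ oc _ (fun y => w y (vf_rep c S y))); [|by []|exact: hY].
by move=> y cy; exact: (omega_loc_linear_r A oc (@hL c)).
Qed.

Lemma omega_L_linear_l (q : TkM) v : scalar (omega_L L A q ^~ v).
Proof.
have cq : tgt (chart_at q) (phi (chart_at q) q).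
  apply: (atlas_phi Tk1_c1_atlas); exact: (atlas_chart_at Tk1_c1_atlas).
move=> a u w; rewrite !omega_L_chart_at.
exact: (omega_loc_linear_l A (Tk1_tgt_open _) (@hL _)).
Qed.

Lemma omega_L_linear_r (q : TkM) u : scalar (omega_L L A q u).
Proof.
have cq : tgt (chart_at q) (phi (chart_at q) q).
  apply: (atlas_phi Tk1_c1_atlas); exact: (atlas_chart_at Tk1_c1_atlas).
move=> a v w; rewrite !omega_L_chart_at.
exact: (omega_loc_linear_r A (Tk1_tgt_open _) (@hL _)).
Qed.

(** In the chart attached to q, differentiate omega(S, Y) by applying the Leibniz rule to each
    of the two arguments, then substitute D_X S = [X, S] + D_S X, and likewise for Y.  The
    terms D_S X and D_Y X are those of the Lie derivative of omega. *)
Lemma lie_contraction (X : vfield TkM) (q : TkM) :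
  lie_fun X Phi q = lie_form2 X (omega_L L A) q (S q) (Y q)
    + omega_L L A q (lie_vf X S q) (Y q) + omega_L L A q (S q) (lie_vf X Y q).
Proof.
have oc := Tk1_tgt_open (chart_at q).
pose c := chart_at q; pose x := phi c q; pose f := L \o psi c.
have cx : tgt c x.
  apply: (atlas_phi Tk1_c1_atlas); exact: (atlas_chart_at Tk1_c1_atlas).
have Sx : vf_rep c S x = S q by exact: (vf_rep_id Tk1_c1_atlas).
have Yx : vf_rep c Y x = Y q by exact: (vf_rep_id Tk1_c1_atlas).
have dS := smooth_on_differentiable (@hS c) cx.
have dY := smooth_on_differentiable (@hY c) cx.
have ll v z : tgt c z -> scalar (omega_loc A f z ^~ v).
  by move=> cz; exact: (omega_loc_linear_l A oc (@hL c)).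
have lr u z : tgt c z -> scalar (omega_loc A f z u).
  by move=> cz; exact: (omega_loc_linear_r A oc (@hL c)).
have dw u v : differentiable (fun z => omega_loc A f z u v) x.
  exact: smooth_on_differentiable (smooth_on_omega_loc A oc (@hL c) u v) cx.
have ll' v : \forall z \near x, scalar (omega_loc A f z ^~ v).
  by apply: filterS (near_open oc cx) => z; exact: ll.
have E0 : lie_fun X Phi q
    = 'D_(X q) (fun z => omega_loc A f z (vf_rep c S z) (vf_rep c Y z)) x.
  apply: near_eq_derive; apply: filterS (near_open oc cx) => z cz.
  exact: contraction_rep.
have E1 : 'D_(X q) (fun z => omega_loc A f z (vf_rep c S z) (vf_rep c Y z)) x
    = 'D_(X q) (fun z => omega_loc A f z (vf_rep c S z) (Y q)) x
      + omega_loc A f x (S q) ('D_(X q) (vf_rep c Y) x).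
  rewrite -Sx -Yx.
  apply: (@derive_pairing _ _ _ (fun z => omega_loc A f z (vf_rep c S z))) => //.
    by apply: filterS (near_open oc cx) => z; exact: lr.
  move=> e; exact: (@differentiable_pairing _ _ _ (fun z u => omega_loc A f z u e)).
have E2 : 'D_(X q) (fun z => omega_loc A f z (vf_rep c S z) (Y q)) x
    = 'D_(X q) (fun z => omega_loc A f z (S q) (Y q)) x
      + omega_loc A f x ('D_(X q) (vf_rep c S) x) (Y q).
  rewrite -Sx.
  exact: (@derive_pairing _ _ _ (fun z u => omega_loc A f z u (Y q))).
have E3 : 'D_(X q) (fun z => form2_rep c (omega_L L A) z (S q) (Y q)) x
    = 'D_(X q) (fun z => omega_loc A f z (S q) (Y q)) x.
  apply: near_eq_derive; apply: filterS (near_open oc cx) => z cz.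
  exact: omega_L_rep.
have DS : 'D_(X q) (vf_rep c S) x = 1 *: lie_vf X S q + 'D_(S q) (vf_rep c X) x.
  by rewrite scale1r subrK.
have DY : 'D_(X q) (vf_rep c Y) x = 1 *: lie_vf X Y q + 'D_(Y q) (vf_rep c X) x.
  by rewrite scale1r subrK.
have wE u v : omega_L L A q u v = omega_loc A f x u v by exact: omega_L_chart_at.
have F1 := etrans (congr1 (omega_loc A f x ^~ (Y q)) DS) (ll (Y q) x cx _ _ _).
have F2 := etrans (congr1 (omega_loc A f x (S q)) DY) (lr (S q) x cx _ _ _).
have alg (d a b a' b' : R) : (d + (1 * a + b)) + (1 * a' + b') = (d + b + b') + a + a'.
  by ring.
refine (etrans E0 (etrans (etrans E1 (congr2 +%R (etrans E2 (congr1 (+%R _) F1)) F2))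
  (etrans (alg _ _ _ _ _) _))).
rewrite /lie_form2 !wE.
exact: (congr1 (fun r => r + _ + _ + _ + _) (esym E3)).
Qed.

End Contraction.
End TangentAtlas.

Arguments Tk1_tgt_open {R n} k {M} hM c.

(** * Conservation laws from symmetries and pseudosymmetries *)

Theorem corollary5p9 (R : realType) (n k : nat) (M : charted R n)
    (hM : is_manifold M)
    (L : Tk1 k M -> R) (hL : smooth_map L) (hreg : regular_lagrangian L)
    (X : 'I_k -> vfield (Tk1 k M)) (hX : smooth_kvf X) (hXint : integrable_kvf X)
    (hXev : evolution L (energy L) X)
    (hXomega : forall (A : 'I_k) q u w, lie_form2 (X A) (omega_L L A) q u w = 0)
    (Y : vfield (Tk1 k M)) (hY : smooth_vf Y) (hYsym : symmetry X Y) :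
  (forall S : vfield (Tk1 k M), smooth_vf S ->
     pseudosymmetry X (fun _ : 'I_k => Y) S ->
     conservation_law X (fun q => \row_(A < k) omega_L L A q (S q) (Y q)))
  /\
  (forall S : vfield (Tk1 k M), smooth_vf S -> symmetry X S ->
     conservation_law X (fun q => \row_(A < k) omega_L L A q (S q) (Y q))).
Proof.
have main (S : vfield (Tk1 k M)) : smooth_vf S ->
    (forall A q, exists l, lie_vf (X A) S q = l *: Y q) ->
    conservation_law X (fun q => \row_(A < k) omega_L L A q (S q) (Y q)).
  move=> hS XS; split.
    move=> c; apply: (@smooth_on_mx _ _ _ (Tk1_tgt_open k hM c) 1 k
      (fun _ A y => omega_L L A (psi c y) (S (psi c y)) (Y (psi c y)))) => i A.
    exact: (smooth_contraction hM hL A hS hY).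
  move=> q; apply: big1 => A _.
  have -> : (fun p : Tk1 k M => (\row_(B < k) omega_L L B p (S p) (Y p)) 0 A)
      = (fun p => omega_L L A p (S p) (Y p)) by apply/funext => p; rewrite mxE.
  have ll := omega_L_linear_l hM hL A.
  have lr := omega_L_linear_r hM hL A.
  have [l XSq] := XS A q.
  rewrite (lie_contraction hM hL A hS hY) hXomega XSq hYsym.
  have wYY : omega_L L A q (Y q) (Y q) = 0.
    by rewrite (omega_L_chart_at hM hL); exact: omega_loc_alt.
  (* l Y is written (l - 1) Y + Y to fit the shape a u + v of linearity. *)
  have := ll q (Y q) (l - 1) (Y q) (Y q); rewrite wYY scalerBl scale1r subrK mulr0 => ->.
  (* omega(S, 0) = 0, from 0 = -1 * 0 + 0. *)
  have := lr q (S q) (-1) 0 0; rewrite scaler0 addr0 => ->.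
  by ring.
split=> S hS XS; apply: main => // A q.
  have [lambda [_ ->]] := XS A; exists (\sum_(B < k) lambda B q).
  by rewrite scaler_suml.
by exists 0; rewrite scale0r.
Qed.
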